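(* Let $n\ge1$, let $\mathcal U_1,\dots,\mathcal U_D$ be unitary channels on $n$ qubits and let $T$ be a quantum channel on $n$ qubits with $T(\sigma)=\sigma$, where $\sigma=I/2^n$. Let $\Phi=T\circ\mathcal U_D\circ\cdots\circ T\circ\mathcal U_1$ be the channel of the noisy quantum device. Then for every $n$-qubit state $\rho$ and every Hamiltonian $H$ on $n$ qubits, $$\mathrm{tr}(\Phi(\rho)H)\ \ge\ \sup_{\beta>0}\ \beta^{-1}\left(n\log 2-\log\left(\mathrm{tr}\left(e^{-\beta H}\right)\right)-D(\Phi(\rho)\|\sigma)\right).$$
   Context: States are positive semidefinite trace-one operators on $(\mathbb C^2)^{\otimes n}$; Hamiltonians are Hermitian operators. $\log$ is the natural logarithm and $D(\rho\|\sigma)=\mathrm{tr}(\rho(\log\rho-\log\sigma))$ is the quantum relative entropy. A unitary channel is a map $\rho\mapsto U\rho U^\dagger$ with $U$ unitary. *)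

(* Defs.v *)
From HB Require Import structures.
From mathcomp Require Import all_boot all_order all_algebra.
From mathcomp Require Import all_classical all_reals all_analysis.
From mathcomp Require Import complex mxtens.

Set Implicit Arguments.
Unset Strict Implicit.
Unset Printing Implicit Defensive.

Import Order.TTheory GRing.Theory Num.Theory.

Local Open Scope ring_scope.
Local Open Scope complex_scope.
Local Open Scope sesquilinear_scope.

(* Operators on (C^2)^{\otimes n} are the matrices 'M[R[i]]_(2 ^ n), with respect
   to the product basis; the definitions below make sense in any dimension d. *)

(* The order on R[i] is partial: 0 <= z says that z is real and nonnegative. *)
Definition psdmx (R : realType) d (A : 'M[R[i]]_d) : Prop :=
  A \is hermsymmx /\ forall v : 'cV[R[i]]_d, 0 <= (v^t* *m A *m v) 0 0.

Definition is_state (R : realType) d (rho : 'M[R[i]]_d) : Prop :=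
  psdmx rho /\ \tr rho = 1.

(* The extension T \otimes id_k of T to 'M_d \otimes 'M_k, computed by applying T
   to the d x d blocks of X; see ampliation_tens. *)
Definition ampliation (R : realType) d k (T : 'M[R[i]]_d -> 'M[R[i]]_d)
    (X : 'M[R[i]]_(d * k)) : 'M[R[i]]_(d * k) :=
  \sum_(a < k) \sum_(b < k)
    T (\matrix_(i, j) X (mxtens_index (i, a)) (mxtens_index (j, b)))
      *t delta_mx a b.

Definition completely_positive (R : realType) d
    (T : 'M[R[i]]_d -> 'M[R[i]]_d) : Prop :=
  forall k (X : 'M[R[i]]_(d * k)), psdmx X -> psdmx (ampliation T X).

Definition trace_preserving (R : realType) d
    (T : 'M[R[i]]_d -> 'M[R[i]]_d) : Prop :=
  forall X, \tr (T X) = \tr X.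

Definition quantum_channel (R : realType) d
    (T : 'M[R[i]]_d -> 'M[R[i]]_d) : Prop :=
  [/\ linear T, completely_positive T & trace_preserving T].

Definition unitary_channel (R : realType) d
    (F : 'M[R[i]]_d -> 'M[R[i]]_d) : Prop :=
  exists2 V : 'M[R[i]]_d, V \is unitarymx & forall X, F X = V *m X *m V^t*.

(* T \o U_{D-1} \o ... \o T \o U_0: foldl applies U_0 first. *)
Definition noisy_device (R : realType) d D (T : 'M[R[i]]_d -> 'M[R[i]]_d)
    (U : 'I_D -> 'M[R[i]]_d -> 'M[R[i]]_d) (rho : 'M[R[i]]_d) : 'M[R[i]]_d :=
  foldl (fun X F => T (F X)) rho [seq U i | i <- enum 'I_D].

(* Functional calculus f(A) of a Hermitian matrix A. The eigenvalues
   spectral_diag A are then real, so taking their real part only serves to view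
   them in R. The result does not depend on the diagonalization: hermfunE. *)
Definition hermfun (R : realType) d (f : R -> R) (A : 'M[R[i]]_d) : 'M[R[i]]_d :=
  invmx (spectralmx A)
    *m diag_mx (map_mx (fun z => (f (complex.Re z))%:C) (spectral_diag A))
    *m spectralmx A.

Definition expm (R : realType) d (A : 'M[R[i]]_d) : 'M[R[i]]_d :=
  hermfun (@expR R) A.

(* As ln 0 = 0 in the library, logm A is the logarithm of A on the support of A
   and vanishes on its kernel, whence 0 log 0 = 0 in rel_entropy. *)
Definition logm (R : realType) d (A : 'M[R[i]]_d) : 'M[R[i]]_d :=
  hermfun (@ln R) A.

Definition retr (R : realType) d (A : 'M[R[i]]_d) : R := complex.Re (\tr A).

(* D(rho || sigma) is +oo unless the kernel of sigma is contained in that of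
   rho, which is always the case for an invertible sigma. *)
Definition rel_entropy (R : realType) d (rho sigma : 'M[R[i]]_d) : \bar R :=
  if (kermx sigma <= kermx rho)%MS
  then (retr (rho *m (logm rho - logm sigma)))%:E
  else +oo%E.

Definition maximally_mixed (R : realType) n : 'M[R[i]]_(2 ^ n) :=
  ((2 ^ n)%:R^-1)%:M.

Lemma ampliation_tens (R : realType) d k (T : 'M[R[i]]_d -> 'M[R[i]]_d)
    (A : 'M[R[i]]_d) (B : 'M[R[i]]_k) :
  linear T -> ampliation T (A *t B) = T A *t B.
Proof.
move=> lT.
have T0 : T 0 = 0.
  by have := lT (-1) 0 0; rewrite !scaleN1r oppr0 addr0 addNr.
have TZ c X : T (c *: X) = c *: T X by have := lT c X 0; rewrite T0 !addr0.
rewrite /ampliation; apply/matrixP => i j.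
case: (mxtens_indexP i) => {i} i1 i2; case: (mxtens_indexP j) => {j} j1 j2.
rewrite summxE (bigD1 i2)//= summxE (bigD1 j2)//= big1 ?addr0; last first.
  by move=> b bj; rewrite tensmxE mxE [j2 == b]eq_sym (negbTE bj) andbF mulr0.
rewrite big1 ?addr0; last first.
  move=> a ai; rewrite summxE big1// => b _.
  by rewrite tensmxE mxE [i2 == a]eq_sym (negbTE ai) mulr0.
have -> : \matrix_(i, j) (A *t B) (mxtens_index (i, i2)) (mxtens_index (j, j2))
    = B i2 j2 *: A.
  by apply/matrixP => i j; rewrite !mxE !mxtens_indexK mulrC.
by rewrite TZ !tensmxE !mxE !eqxx mulr1 mulrC.
Qed.

Lemma hermfunE (R : realType) d (f : R -> R) (P : 'M[R[i]]_d) (v : 'rV[R]_d) :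
  P \is unitarymx ->
  hermfun f (P^t* *m diag_mx (map_mx (real_complex R) v) *m P)
    = P^t* *m diag_mx (map_mx (fun x => (f x)%:C) v) *m P.
Proof.
move=> Pu; have Pi : invmx P = P^t* by exact: invmx_unitary.
have Pun := unitarymx_unit Pu.
set A := _ *m _ *m P.
have An : A \is normalmx.
  apply/orthomx_spectral_subproof; exists (P, map_mx (real_complex R) v) => //=.
  by rewrite Pi.
have := orthomx_spectralP An; rewrite /hermfun.
set Q := spectralmx A; set s := spectral_diag A => AE.
have Qun : Q \in unitmx := spectral_unit A.
pose W := P *m invmx Q.
have com : diag_mx (map_mx (real_complex R) v) *m W = W *m diag_mx s.
  have -> : diag_mx s = Q *m A *m invmx Q.
    by rewrite AE !mulmxA mulmxV// mul1mx mulmxK.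
  by rewrite /W /A -Pi !mulmxA mulmxKV// mulmxV// mul1mx.
suff com' : diag_mx (map_mx (fun x => (f x)%:C) v) *m W
    = W *m diag_mx (map_mx (fun z => (f (complex.Re z))%:C) s).
  have WQ : W *m Q = P by rewrite mulmxKV.
  have -> : invmx Q = P^t* *m W by rewrite -Pi mulKmx.
  by rewrite -(mulmxA (P^t*) W) -com' -(mulmxA _ _ Q) -(mulmxA _ W Q) WQ mulmxA.
clearbody W.
apply/matrixP => i j; move/matrixP/(_ i j): com.
rewrite !mul_diag_mx !mul_mx_diag !mxE.
have [->|W0] := eqVneq (W i j) 0; first by rewrite !mulr0 !mul0r.
by rewrite mulrC => /(mulfI W0) <- /=; rewrite mulrC.
Qed.

(* Main.v *)
(* Phi rho is again a state and D(Phi rho || I/2^n) = tr(Phi rho log Phi rho) +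
   n log 2, so the bound is Gibbs' variational principle
     - log tr(e^-K) <= tr(r log r) + tr(r K)
   for r = Phi rho and K = beta H. With p_i and h_j the eigenvalues of r and K,
   the squared overlaps m_ij of their eigenbases form a doubly stochastic matrix.
   For the Gibbs weights q_j = e^-h_j / tr(e^-K), averaging the scalar inequality
   p_i log p_i - p_i log q_j >= p_i - q_j with the weights m_ij gives the claim,
   because both p and q sum to 1. *)

Require Import Defs.
From HB Require Import structures.
From mathcomp Require Import all_boot all_order all_algebra.
From mathcomp Require Import all_classical all_reals all_analysis.
From mathcomp Require Import complex mxtens.
From mathcomp Require Import ring lra.

Set Implicit Arguments.
Unset Strict Implicit.
Unset Printing Implicit Defensive.

Import Order.TTheory GRing.Theory Num.Theory.

Local Open Scope classical_set_scope.
Local Open Scope ring_scope.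
Local Open Scope complex_scope.
Local Open Scope sesquilinear_scope.

(** * States are preserved by unitary conjugations, channels and the noisy device *)

Lemma adjmxM (C : numClosedFieldType) m n p (A : 'M[C]_(m, n))
    (B : 'M[C]_(n, p)) : (A *m B)^t* = B^t* *m A^t*.
Proof. by rewrite trmx_mul map_mxM. Qed.

Lemma hermsymmxE (C : numClosedFieldType) n (A : 'M[C]_n) :
  (A \is hermsymmx) = (A == A^t*).
Proof. by rewrite is_hermitianmxE expr0 scale1r. Qed.

Lemma psdmx_congr (R : realType) m n (V : 'M[R[i]]_(m, n)) (X : 'M[R[i]]_n) :
  psdmx X -> psdmx (V *m X *m V^t*).
Proof.
move=> [Xh Xp]; split.
  move: Xh; rewrite !hermsymmxE => /eqP Xh.
  by rewrite !adjmxM trmxCK -Xh mulmxA.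
move=> v; have := Xp (V^t* *m v).
by rewrite adjmxM trmxCK !mulmxA.
Qed.

Lemma is_state_unitary (R : realType) d (V rho : 'M[R[i]]_d) :
  V \is unitarymx -> is_state rho -> is_state (V *m rho *m V^t*).
Proof.
move=> Vu [rhop rho1]; split; first exact: psdmx_congr.
rewrite mxtrace_mulC mulmxA -invmx_unitary// mulVmx ?mul1mx//.
exact: unitarymx_unit.
Qed.

(* The isometry C^d -> C^d \otimes C^1, in the indexing of tensmx. *)
Definition tens1_iso (C : numClosedFieldType) d : 'M[C]_(d * 1, d) :=
  \matrix_(k, i) ((mxtens_unindex k).1 == i)%:R.

Lemma tens1_isoE (C : numClosedFieldType) d (A : 'M[C]_d) :
  A *t (1%:M : 'M[C]_1) = tens1_iso C d *m A *m (tens1_iso C d)^t*.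
Proof.
apply/matrixP => i j.
case: (mxtens_indexP i) => {i} i1 i2; case: (mxtens_indexP j) => {j} j1 j2.
rewrite tensmxE !mxE (bigD1 j1)// big1 => [|k kj]; last first.
  by rewrite !mxE mxtens_indexK/= eq_sym (negbTE kj) conjC0 mulr0.
rewrite !mxE (bigD1 i1)// big1 => [|k ki]; last first.
  by rewrite !mxE mxtens_indexK/= eq_sym (negbTE ki) mul0r.
by rewrite !mxE !mxtens_indexK/= !ord1 !eqxx conjC1 !addr0 !mulr1 mul1r.
Qed.

Lemma tens1_isoK (C : numClosedFieldType) d :
  (tens1_iso C d)^t* *m tens1_iso C d = 1%:M.
Proof.
apply/matrixP => i j; rewrite !mxE (bigD1 (mxtens_index (i, ord0)))//= big1.
  by rewrite !mxE !mxtens_indexK/= eqxx conjC1 mul1r addr0.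
move=> k; case: (mxtens_indexP k) => {k} k1 k2 ki.
rewrite !mxE mxtens_indexK/=.
have [kE|_] := eqVneq k1 i; last by rewrite conjC0 mul0r.
by move: ki; rewrite kE ord1 eqxx.
Qed.

(** Tensoring with the 1 x 1 identity is conjugation by an isometry, and conjugating by its adjoint
    undoes it; both maps preserve positivity. *)
Lemma psdmx_tens1 (R : realType) d (A : 'M[R[i]]_d) :
  psdmx (A *t (1%:M : 'M[R[i]]_1)) <-> psdmx A.
Proof.
rewrite tens1_isoE; split=> [Ap|]; last exact: psdmx_congr.
have := psdmx_congr ((tens1_iso _ d)^t*) Ap.
by rewrite trmxCK !mulmxA tens1_isoK mul1mx -mulmxA tens1_isoK mulmx1.
Qed.

Lemma is_state_channel (R : realType) d (T : 'M[R[i]]_d -> 'M[R[i]]_d) rho :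
  quantum_channel T -> is_state rho -> is_state (T rho).
Proof.
move=> [lT cpT tpT] [rhop rho1]; split; last by rewrite tpT.
(* Positivity of [T] is complete positivity with an ancilla of dimension [k = 1]. *)
apply/psdmx_tens1; rewrite -ampliation_tens//; apply: cpT.
exact/psdmx_tens1.
Qed.

Lemma is_state_noisy_device (R : realType) d D
    (T : 'M[R[i]]_d -> 'M[R[i]]_d) (U : 'I_D -> 'M[R[i]]_d -> 'M[R[i]]_d) rho :
  quantum_channel T -> (forall i, unitary_channel (U i)) -> is_state rho ->
  is_state (noisy_device T U rho).
Proof.
move=> hT hU; rewrite /noisy_device.
elim: (enum 'I_D) rho => [//|i s IH] rho hrho /=.
apply: IH; apply: is_state_channel => //.
by have [V Vu ->] := hU i; apply: is_state_unitary.
Qed.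

(** * Real diagonalizations, functional calculus and eigenbasis overlaps *)

(** For unitary [P], the adjoint of row [i] of [P] is an eigenvector with eigenvalue [v 0 i].
    Keeping [v] over [R] lets the entropy estimates run over the reals. *)
Definition unitary_diag (R : realType) d (P : 'M[R[i]]_d) (v : 'rV[R]_d) :=
  P^t* *m diag_mx (map_mx (real_complex R) v) *m P.

Lemma hermsymmx_diag (R : realType) d (A : 'M[R[i]]_d) : A \is hermsymmx ->
  exists (P : 'M[R[i]]_d) (v : 'rV[R]_d), P \is unitarymx /\ A = unitary_diag P v.
Proof.
move=> Ah; have AE := orthomx_spectralP (hermitian_normalmx Ah).
have := hermitian_spectral_diag_real Ah; have := spectral_unitarymx A.
move: AE; move: (spectralmx A) (spectral_diag A) => P s -> Pu /mxOverP sr.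
exists P, (map_mx (@complex.Re R) s); split; first exact: Pu.
rewrite (invmx_unitary Pu) /unitary_diag.
suff -> : map_mx (real_complex R) (map_mx (@complex.Re R) s) = s by [].
by apply/rowP => j; rewrite !mxE; apply: RRe_real.
Qed.

Lemma hermfun_diag (R : realType) d (f : R -> R) (P : 'M[R[i]]_d) v :
  P \is unitarymx ->
  hermfun f (unitary_diag P v) = unitary_diag P (map_mx f v).
Proof.
move=> Pu; rewrite /unitary_diag (hermfunE _ _ Pu).
suff -> : map_mx (real_complex R) (map_mx f v) = map_mx (fun x => (f x)%:C) v.
  by [].
by apply/rowP => j; rewrite !mxE.
Qed.

Lemma hermfun_scalar (R : realType) d (f : R -> R) (c : R) :
  hermfun f (c%:C%:M : 'M[R[i]]_d) = (f c)%:C%:M.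
Proof.
have E x : x%:C%:M = unitary_diag (1%:M : 'M[R[i]]_d) (const_mx x).
  by rewrite /unitary_diag mulmx1 trmx1 map_mx1 mul1mx map_const_mx diag_const_mx.
have Iu : (1%:M : 'M[R[i]]_d) \is unitarymx.
  by apply/unitarymxP; rewrite trmx1 map_mx1 mul1mx.
by rewrite (E c) (hermfun_diag _ _ Iu) (E (f c)) map_const_mx.
Qed.

Lemma retr_unitary_diag (R : realType) d (P : 'M[R[i]]_d) v :
  P \is unitarymx -> retr (unitary_diag P v) = \sum_i v 0 i.
Proof.
move=> Pu; rewrite /retr /unitary_diag -mulmxA mxtrace_mulC -mulmxA.
rewrite (unitarymxP Pu) mulmx1 mxtrace_diag.
under eq_bigr do rewrite mxE.
by rewrite -rmorph_sum.
Qed.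

(** The squared modulus of the inner product of the [i]-th eigenvector of one basis with the [j]-th
    of the other, as an element of [R]. *)
Definition overlap (R : realType) d (P Q : 'M[R[i]]_d) i j : R :=
  let z := (P *m Q^t*) i j in complex.Re z ^+ 2 + complex.Im z ^+ 2.

Lemma overlapE (R : realType) d (P Q : 'M[R[i]]_d) i j :
  (overlap P Q i j)%:C = (P *m Q^t*) i j * ((P *m Q^t*) i j)^*%R.
Proof. by rewrite /overlap add_Re2_Im2 normCK. Qed.

Lemma overlap_ge0 (R : realType) d (P Q : 'M[R[i]]_d) i j : 0 <= overlap P Q i j.
Proof. by rewrite addr_ge0 ?sqr_ge0. Qed.

(** Swapping the bases conjugates the inner product. This turns the row sums of [sum_overlap] into
    column sums. *)
Lemma overlap_sym (R : realType) d (P Q : 'M[R[i]]_d) i j :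
  overlap P Q i j = overlap Q P j i.
Proof.
apply: (@complexI R); rewrite !overlapE.
have -> : Q *m P^t* = (P *m Q^t*)^t* by rewrite adjmxM trmxCK.
by move: (P *m Q^t*) => W; rewrite !mxE conjCK mulrC.
Qed.

(** The rows of the unitary matrix [P *m Q^t*] have norm 1. *)
Lemma sum_overlap (R : realType) d (P Q : 'M[R[i]]_d) i :
  P \is unitarymx -> Q \is unitarymx -> \sum_j overlap P Q i j = 1.
Proof.
move=> Pu Qu; apply: (@complexI R); rewrite rmorph_sum.
have Qu' : Q^t* \is unitarymx by rewrite trmxC_unitary.
have := unitarymxP (mul_unitarymx Pu Qu').
move=> /matrixP/(_ i i); rewrite [RHS]mxE eqxx [LHS]mxE => W1; apply: etrans W1.
apply: eq_bigr => j _; apply: etrans (overlapE P Q i j) _.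
by move: (P *m Q^t*) => W; rewrite !mxE.
Qed.

Lemma retr_mul_unitary_diag (R : realType) d (P Q : 'M[R[i]]_d) p h :
  retr (unitary_diag P p *m unitary_diag Q h)
  = \sum_i \sum_j overlap P Q i j * (p 0 i * h 0 j).
Proof.
(* Cyclicity of the trace brings [B'] next to [A], so that [P] and [Q] enter only through
   [P *m Q^t*] and its adjoint. *)
have trE (A B A' B' X Y : 'M[R[i]]_d) : \tr (A *m X *m B *m (A' *m Y *m B'))
    = \tr (X *m (B *m A' *m (Y *m (B' *m A)))).
  by rewrite -!mulmxA mxtrace_mulC -!mulmxA.
have QPE : Q *m P^t* = (P *m Q^t*)^t* by rewrite adjmxM trmxCK.
rewrite /retr /unitary_diag trE QPE.
suff -> : \tr (diag_mx (map_mx (real_complex R) p) *m (P *m Q^t* *m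
      (diag_mx (map_mx (real_complex R) h) *m (P *m Q^t*)^t*)))
    = (\sum_i \sum_j overlap P Q i j * (p 0 i * h 0 j))%:C by [].
rewrite /mxtrace rmorph_sum; apply: eq_bigr => i _.
rewrite mul_diag_mx !mxE mulr_sumr [RHS]rmorph_sum; apply: eq_bigr => j _.
rewrite [RHS]rmorphM [X in _ = X * _]overlapE [X in _ = _ * X]rmorphM.
move: (P *m Q^t*) => W; rewrite mul_diag_mx !mxE /=.
by ring.
Qed.

Lemma psdmx_unitary_diag (R : realType) d (P : 'M[R[i]]_d) p i :
  P \is unitarymx -> psdmx (unitary_diag P p) -> 0 <= p 0 i.
Proof.
move=> Pu /(psdmx_congr P) [_].
have PP := unitarymxP Pu.
have -> : P *m unitary_diag P p *m P^t* = diag_mx (map_mx (real_complex R) p).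
  by rewrite /unitary_diag !mulmxA PP mul1mx -mulmxA PP mulmx1.
move=> /(_ (delta_mx i 0)).
rewrite trmx_delta map_delta_mx -rowE -colE !mxE eqxx mulr1n.
by rewrite ler0c.
Qed.

Lemma unitary_diagM (R : realType) d (P : 'M[R[i]]_d) u v :
  P \is unitarymx ->
  unitary_diag P u *m unitary_diag P v = unitary_diag P (\row_i (u 0 i * v 0 i)).
Proof.
move=> /unitarymxP PP; rewrite /unitary_diag.
set Du := diag_mx _; set Dv := diag_mx (map_mx _ v).
rewrite !mulmxA -(mulmxA (P^t* *m Du) P) PP mulmx1 -(mulmxA (P^t*) Du).
rewrite mulmx_diag; congr (_ *m diag_mx _ *m _).
by apply/rowP => i; rewrite !mxE rmorphM.
Qed.

(** * Gibbs' variational principle *)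

(** For [p > 0] this is [1 + y <= expR y] at [y = x - ln p], multiplied by [p]; at [p = 0] it only
    says that [expR x] is nonnegative. *)
Lemma gibbs_pointwise (R : realType) (p x : R) :
  0 <= p -> p - expR x <= p * ln p - p * x.
Proof.
rewrite le_eqVlt => /predU1P[<-|p0].
  by rewrite !mul0r subr0 sub0r oppr_le0 expR_ge0.
have := expR_ge1Dx (x - ln p).
rewrite expRD expRN lnK ?posrE// ler_pdivlMr// => H.
by rewrite -mulrBr; lra.
Qed.

Lemma gibbs_variational (R : realType) d (rho H : 'M[R[i]]_d) :
  is_state rho -> H \is hermsymmx ->
  - ln (retr (expm (- H))) <= retr (rho *m logm rho) + retr (rho *m H).
Proof.
move=> [rhop rho1] Hh; have [rhoh _] := rhop.
have [P [p [Pu rhoE]]] := hermsymmx_diag rhoh.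
have [Q [h [Qu HE]]] := hermsymmx_diag Hh.
have p0 i : 0 <= p 0 i.
  by apply: (psdmx_unitary_diag i Pu); rewrite -rhoE.
have p1 : \sum_i p 0 i = 1.
  by rewrite -(retr_unitary_diag p Pu) -rhoE /retr rho1.
have -> : - H = unitary_diag Q (- h).
  by rewrite HE /unitary_diag map_mxN linearN/= mulmxN mulNmx.
rewrite /expm /logm rhoE HE !hermfun_diag// retr_unitary_diag//.
rewrite unitary_diagM// retr_unitary_diag// retr_mul_unitary_diag.
set Z := \sum_i map_mx _ _ 0 i.
have Z0 : 0 < Z.
  (* An empty sum would make [Z] vanish; since the [p 0 i] sum to 1, some index exists. *)
  have [j _ _] : exists2 j, j \in 'I_d & p 0 j != 0.
    apply/exists_inP; rewrite -negb_forall_in; apply/negP => /forall_inP q0.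
    by move/eqP: p1; rewrite big1 1?eq_sym ?oner_eq0// => i _; apply/eqP/q0.
  rewrite /Z (bigD1 j)//= ltr_wpDr//.
    by apply: sumr_ge0 => i _; rewrite mxE expR_ge0.
  by rewrite mxE expR_gt0.
(* The logarithm of the Gibbs weight q_j. *)
pose x j := - h 0 j - ln Z.
have expx1 : \sum_j expR (x j) = 1.
  rewrite /x; under eq_bigr do rewrite expRB lnK ?posrE//.
  rewrite -mulr_suml -[RHS](mulfV (lt0r_neq0 Z0)); congr (_ * _).
  by apply: eq_bigr => j _; rewrite !mxE.
have le_sums : \sum_i \sum_j overlap P Q i j * (p 0 i - expR (x j))
    <= \sum_i \sum_j overlap P Q i j * (p 0 i * ln (p 0 i) - p 0 i * x j).
  apply: ler_sum => i _; apply: ler_sum => j _.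
  by rewrite ler_wpM2l ?overlap_ge0 ?gibbs_pointwise.
have lhs0 : \sum_i \sum_j overlap P Q i j * (p 0 i - expR (x j)) = 0.
  under eq_bigr do under eq_bigr do rewrite mulrBr.
  under eq_bigr do rewrite sumrB -mulr_suml sum_overlap// mul1r.
  (* The weights [expR (x j)] depend on the column only, so they are summed over the rows first. *)
  rewrite sumrB p1 exchange_big/=.
  under [X in _ - X]eq_bigr => j _.
    rewrite -mulr_suml; under eq_bigr do rewrite overlap_sym.
    rewrite sum_overlap// mul1r; over.
  by rewrite expx1 subrr.
have rhsE : \sum_i \sum_j overlap P Q i j * (p 0 i * ln (p 0 i) - p 0 i * x j)
    = \sum_i p 0 i * ln (p 0 i)
      + \sum_i \sum_j overlap P Q i j * (p 0 i * h 0 j) + ln Z.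
  (* Terms independent of [j] are spread over [j] with the overlaps as weights, and [ln Z] over [i]
     with the weights [p 0 i]; the summands then agree. *)
  rewrite -[ln Z]mul1r -p1 mulr_suml -!big_split/=; apply: eq_bigr => i _.
  have avg c : c = \sum_j overlap P Q i j * c.
    by rewrite -mulr_suml sum_overlap// mul1r.
  rewrite [X in _ = X + _ + _]avg [X in _ = _ + X]avg -!big_split/=.
  by apply: eq_bigr => j _; rewrite /x; ring.
have rowE : \sum_i (\row_i (p 0 i * map_mx (@ln R) p 0 i)) 0 i
    = \sum_i p 0 i * ln (p 0 i) by apply: eq_bigr => i _; rewrite !mxE.
by rewrite rowE; move: le_sums; rewrite lhs0 rhsE; lra.
Qed.

(** * Relative entropy to the maximally mixed state, and the energy bound *)

Lemma maximally_mixedE (R : realType) n :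
  maximally_mixed R n = ((2 ^ n)%:R^-1 : R)%:C%:M.
Proof. by rewrite /maximally_mixed fmorphV rmorph_nat. Qed.

Lemma rel_entropy_maximally_mixed (R : realType) n (rho : 'M[R[i]]_(2 ^ n)) :
  is_state rho ->
  rel_entropy rho (maximally_mixed R n)
  = (retr (rho *m logm rho) + n%:R * ln 2)%:E.
Proof.
move=> [_ rho1].
have d0 : 0 < (2 ^ n)%:R :> R by rewrite ltr0n expn_gt0.
(* A nonzero scalar matrix has trivial kernel, so the relative entropy is finite. *)
rewrite /rel_entropy maximally_mixedE ifT; last first.
  have -> : kermx (((2 ^ n)%:R^-1 : R)%:C%:M : 'M[R[i]]_(2 ^ n)) = 0.
    apply/eqP; rewrite kermx_eq0 row_free_unit unitmxE det_scalar unitrX//.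
    by rewrite unitfE (inj_eq (@complexI R) _ 0) invr_eq0 lt0r_neq0.
  exact: sub0mx.
rewrite /logm hermfun_scalar lnV ?posrE// natrX lnXn// mulmxBr mul_mx_scalar.
rewrite /retr !raddfB/= mxtraceZ rho1 mulr1 /=.
by rewrite opprK mulr_natl.
Qed.

Theorem proposition1 (R : realType) (n : nat) (hn : (1 <= n)%N) (D : nat)
    (U : 'I_D -> 'M[R[i]]_(2 ^ n) -> 'M[R[i]]_(2 ^ n))
    (hU : forall i, unitary_channel (U i))
    (T : 'M[R[i]]_(2 ^ n) -> 'M[R[i]]_(2 ^ n))
    (hT : quantum_channel T)
    (hTfix : T (maximally_mixed R n) = maximally_mixed R n)
    (rho : 'M[R[i]]_(2 ^ n)) (hrho : is_state rho)
    (H : 'M[R[i]]_(2 ^ n)) (hH : H \is hermsymmx) :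
  (ereal_sup
     [set (beta^-1)%:E
            * ((n%:R * ln 2 - ln (retr (expm ((- beta)%:C *: H))))%:E
               - rel_entropy (noisy_device T U rho) (maximally_mixed R n))
     | beta in [set b : R | (0 < b)%R]]
   <= (retr (noisy_device T U rho *m H))%:E)%E.
Proof.
apply: ge_ereal_sup => _ [b /= b0 <-].
have st := is_state_noisy_device hT hU hrho.
rewrite rel_entropy_maximally_mixed//; set r := noisy_device T U rho in st *.
(* All terms are finite, so the claim becomes a real inequality, cleared of the factor 1/b. *)
rewrite -EFinB -EFinM lee_fin mulrC ler_pdivrMr//.
have bHh : b%:C *: H \is hermsymmx.
  move: hH; rewrite !hermsymmxE => /eqP HE; apply/eqP.
  have bC : (b%:C)^*%R = b%:C by apply: conj_Creal; rewrite complex_real.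
  rewrite {1}HE linearZ/=; apply/matrixP => i j; rewrite !mxE rmorphM.
  by rewrite [X in _ = X * _]bC.
(* The two terms [n%:R * ln 2] cancel, which leaves the variational principle for [b%:C *: H]. *)
have := gibbs_variational st bHh.
have -> : retr (r *m (b%:C *: H)) = retr (r *m H) * b.
  rewrite /retr -scalemxAr mxtraceZ; case: (\tr _) => u v /=.
  by rewrite mul0r subr0 mulrC.
by rewrite rmorphN scaleNr; lra.
Qed.
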